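(* Let $(X,d)$ be a complete metric space and let $T:X\to X$ be a self-mapping. For $x,y\in X$ put $$M_1(x,y)=\max\left\{ d(x,y),\ d(x,Tx),\ d(y,Ty),\ \frac{d(x,Tx)\,d(y,Ty)}{1+d(x,y)},\ \frac{d(x,Tx)\,d(y,Ty)}{1+d(Tx,Ty)}\right\}.$$ Suppose that: (1) there exists a function $\psi:\mathbb{R}^+\to\mathbb{R}^+$ such that $\psi(t)<t$ for each $t>0$ and $d(Tx,Ty)\le \psi(M_1(x,y))$ for all $x,y\in X$; (2) for every $\varepsilon>0$ there exists $\delta=\delta(\varepsilon)>0$ such that for all $x,y\in X$, $\varepsilon<M_1(x,y)<\varepsilon+\delta$ implies $d(Tx,Ty)\le\varepsilon$. Then $T$ has a unique fixed point $y_0\in X$, and $T^n x\to y_0$ as $n\to\infty$ for each $x\in X$. Also, $T$ is discontinuous at $y_0$ if and only if $\lim_{x\to y_0} M_1(x,y_0)\neq 0$.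
   Context: Metric spaces are nonempty. $\mathbb{R}^+=[0,\infty)$. $T^n$ denotes the $n$-fold iterate of $T$. The assertion $\lim_{x\to y_0}M_1(x,y_0)\neq 0$ means that it is not the case that $M_1(x,y_0)\to 0$ as $x\to y_0$ (i.e. the limit either does not exist or exists and is nonzero). *)

(* Defs.v *)
From HB Require Import structures.
From mathcomp Require Import all_boot all_order all_algebra.
From mathcomp Require Import all_classical all_reals all_analysis.

Set Implicit Arguments.
Unset Strict Implicit.
Unset Printing Implicit Defensive.

Import Order.TTheory GRing.Theory Num.Theory.
Import numFieldNormedType.Exports.

Local Open Scope classical_set_scope.
Local Open Scope ring_scope.

(* [Complete] includes [isPointed], so these metric spaces are nonempty. *)
#[short(type="completeMetricType")]
HB.structure Definition CompleteMetric (R : numDomainType) :=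
  {X of Complete X & Metric R X}.

Definition M1 (R : realType) (X : metricType R) (T : X -> X) (x y : X) : R :=
  Num.max (mdist x y)
 (Num.max (mdist x (T x))
 (Num.max (mdist y (T y))
 (Num.max (mdist x (T x) * mdist y (T y) / (1 + mdist x y))
          (mdist x (T x) * mdist y (T y) / (1 + mdist (T x) (T y)))))).

(* Main.v *)
Require Import Defs.
From HB Require Import structures.
From mathcomp Require Import all_boot all_order all_algebra.
From mathcomp Require Import all_classical all_reals all_analysis.
From mathcomp Require Import lra.

Set Implicit Arguments.
Unset Strict Implicit.
Unset Printing Implicit Defensive.

Import Order.TTheory GRing.Theory Num.Theory.
Import numFieldNormedType.Exports.
Import metricType_numDomainType.

Local Open Scope classical_set_scope.
Local Open Scope ring_scope.

(** The comparison function enters in two ways. First, it makes [T] strictly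
    contractive with respect to [M1]: [mdist (T x) (T y) < M1 T x y] as soon as
    the right-hand side is positive. Along an orbit the rational terms of [M1]
    are dominated by the step lengths ([M1_orbit]), so this says that the steps
    [mdist (T^n x) (T^n.+1 x)] strictly decrease until they vanish. If their
    limit [l] were positive, the eps-delta condition at [l] would force some
    later step down to [l], after which the next one would drop strictly below
    its limit; hence the steps tend to [0] ([steps_cvg0]).

    Small steps alone do not make the orbit Cauchy; the eps-delta condition
    does. Once the steps are small against [eps] and [delta], points of the
    orbit that are at distance less than [eps + eta] from [T^k x] stay so: such
    a pair has [M1 < eps + delta], so its images are within [eps] (by strict
    contractivity if [M1 <= eps], by the condition otherwise), and going
    back from [T^k.+1 x] to [T^k x] costs one step, less than [eta]
    ([orbit_tail_close]). Completeness then gives a limit [z].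

    The second use of the comparison function is to show [T z = z], without
    any continuity of [T] or of [psi]. Let [a = mdist z (T z)] be positive.
    All the other terms of [M1 (T^n x) z] tend to [0], so that [M1] is
    eventually equal to [a]; therefore [mdist (T^n.+1 x) (T z)] is eventually
    at most the fixed number [psi a < a], although it tends to [a]
    ([orbit_lim_fixed]).

    At a fixed point [y] the function [M1] is just the maximum of [mdist x y]
    and [mdist x (T x)] ([M1_fixed]). By the triangle inequality it tends to [0]
    as [x] tends to [y] exactly when [mdist (T x) y] does, which is continuity
    of [T] at [y]. *)

(** * The control function M1 *)

Definition mdist_strict (R : realType) (X : metricType R) (T : X -> X) :=
  forall x y : X, 0 < M1 T x y -> mdist (T x) (T y) < M1 T x y.

Definition eps_delta_contractive (R : realType) (X : metricType R)
    (T : X -> X) :=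
  forall eps : R, 0 < eps -> exists2 delta : R, 0 < delta &
    forall x y : X, eps < M1 T x y < eps + delta -> mdist (T x) (T y) <= eps.

Lemma ler_div1D (R : realType) (a b : R) : 0 <= a -> 0 <= b -> a / (1 + b) <= a.
Proof. by move=> a0 b0; rewrite ler_pdivrMr ?ler_peMr//; lra. Qed.

Lemma M1_lt (R : realType) (X : metricType R) (T : X -> X) (x y : X) (e : R) :
  mdist x y < e -> mdist x (T x) < e -> mdist y (T y) < e ->
  mdist x (T x) * mdist y (T y) < e -> M1 T x y < e.
Proof.
move=> xye xe ye pe; rewrite /M1 !gt_max xye xe ye /=.
by apply/andP; split; apply: le_lt_trans pe;
  rewrite ler_div1D// ?mulr_ge0 ?mdist_ge0.
Qed.

Lemma mdist_le_M1 (R : realType) (X : metricType R) (T : X -> X) (x y : X) :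
  mdist x y <= M1 T x y.
Proof. by rewrite /M1 le_max lexx. Qed.

Lemma step_le_M1 (R : realType) (X : metricType R) (T : X -> X) (x y : X) :
  mdist y (T y) <= M1 T x y.
Proof. by rewrite /M1 !le_max lexx !orbT. Qed.

(** With [s] and [t] two consecutive steps, the rational terms are
    [s * t / (1 + s) <= t] and [s * t / (1 + t) <= s]. *)
Lemma M1_orbit (R : realType) (X : metricType R) (T : X -> X) (x : X) :
  M1 T x (T x) = Num.max (mdist x (T x)) (mdist (T x) (T (T x))).
Proof.
rewrite /M1; set s := mdist x _; set t := mdist (T x) _.
have s0 : 0 <= s by exact: mdist_ge0.
have t0 : 0 <= t by exact: mdist_ge0.
have st : s * t / (1 + s) <= t.
  by rewrite ler_pdivrMr ?mulrDr ?mulr1; [rewrite [s * t]mulrC|]; lra.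
have ts : s * t / (1 + t) <= s.
  by rewrite ler_pdivrMr ?mulrDr ?mulr1; lra.
by apply/le_anti; rewrite !ge_max !le_max !lexx ts st !orbT.
Qed.

Lemma M1_fixed (R : realType) (X : metricType R) (T : X -> X) (x y : X) :
  T y = y -> M1 T x y = Num.max (mdist x y) (mdist x (T x)).
Proof.
move=> Ty; rewrite /M1 Ty mdistxx mulr0 !mul0r !maxxx.
by congr Num.max; apply/max_idPl/mdist_ge0.
Qed.

Lemma contraction_le (R : realType) (X : metricType R) (T : X -> X) (x y : X) :
  mdist_strict T -> mdist (T x) (T y) <= M1 T x y.
Proof.
move=> Ts; have [/Ts/ltW//|M0] := ltP 0 (M1 T x y).
have : mdist x y = 0.
  by apply/le_anti; rewrite mdist_ge0 andbT (le_trans (mdist_le_M1 _ _ _) M0).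
move=> /mdist_positivity ->.
by rewrite mdistxx (le_trans _ (mdist_le_M1 _ _ _))// mdist_ge0.
Qed.

(** * Convergence of the orbits *)

(** The maximum in [M1_orbit] cannot be the second step, since that step would
    then be smaller than itself. *)
Lemma step_decr (R : realType) (X : metricType R) (T : X -> X) (x : X) :
  mdist_strict T -> 0 < mdist x (T x) ->
  mdist (T x) (T (T x)) < mdist x (T x).
Proof.
move=> Ts s0; have := Ts x (T x); rewrite M1_orbit !lt_max s0 => /(_ isT).
by rewrite ltxx orbF.
Qed.

Lemma step_noninc (R : realType) (X : metricType R) (T : X -> X) (x : X) :
  mdist_strict T -> mdist (T x) (T (T x)) <= mdist x (T x).
Proof.
move=> Ts; have := mdist_ge0 x (T x).
rewrite le_eqVlt => /orP[/eqP/esym/mdist_positivity xTx|/(step_decr Ts)/ltW//].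
by rewrite -!xTx.
Qed.

(** A positive limit of the steps is impossible: it would be approached
    strictly from above, and the eps-delta condition taken at the limit itself
    prevents that. *)
Lemma steps_cvg0 (R : realType) (X : metricType R) (T : X -> X) (x : X) :
  mdist_strict T -> eps_delta_contractive T ->
  mdist (iter n T x) (iter n.+1 T x) @[n --> \oo] --> (0 : R).
Proof.
move=> Ts Ted; set s := fun n => mdist (iter n T x) (iter n.+1 T x).
have s_dec : nonincreasing_seq s.
  by apply/nonincreasing_seqP => n; exact: (step_noninc (iter n T x) Ts).
have s_ge0 n : 0 <= s n by exact: mdist_ge0.
have s_cvg : cvgn s.
  by apply: nonincreasing_is_cvgn => //; exists 0 => _ [n _ <-].
have lim_le n : limn s <= s n by exact: nonincreasing_cvgn_ge.
have lim_ge0 : 0 <= limn s by apply: limr_ge => //; near=> n.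
suff lim0 : limn s = 0 by rewrite -lim0.
apply/le_anti; rewrite lim_ge0 andbT leNgt; apply/negP => lim_gt0.
have s_gt0 n : 0 < s n by exact: lt_le_trans (lim_le n).
have s_lt n : s n.+1 < s n by exact: step_decr (s_gt0 n).
have [delta delta0 Hdelta] := Ted _ lim_gt0.
have [N _ HN] : \forall n \near \oo, s n < limn s + delta.
  by apply: (cvgr_lt _ s_cvg); rewrite ltrDl.
have M1s : M1 T (iter N T x) (T (iter N T x)) = s N.
  by rewrite M1_orbit; apply/max_idPl; exact: (ltW (s_lt N)).
have := Hdelta (iter N T x) (T (iter N T x)); rewrite M1s.
rewrite (le_lt_trans (lim_le N.+1) (s_lt N)) (HN N)//= => /(_ isT).
by rewrite leNgt (le_lt_trans (lim_le N.+2) (s_lt N.+1)).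
Unshelve. all: by end_near. Qed.

(** The Meir-Keeler induction: the bound [eps + eta] on the distance from
    [iter k T x] passes from one point of the orbit to the next. *)
Lemma orbit_tail_close (R : realType) (X : metricType R) (T : X -> X) (x : X)
    (eps : R) :
  mdist_strict T -> eps_delta_contractive T -> 0 < eps ->
  exists k, forall p, mdist (iter k T x) (iter (p + k) T x) < 2 * eps.
Proof.
move=> Ts Ted eps0; have [delta delta0 Hdelta] := Ted _ eps0.
(* [eta <= 1] bounds the product of two steps by [eta]; [eta <= eps] puts the
   steps themselves below [eps + eta] and gives the final [2 * eps]. *)
pose eta := Num.min (Num.min delta eps) 1.
have eta0 : 0 < eta by rewrite !lt_min delta0 eps0 ltr01.
have [eta_delta eta_eps eta1] : [/\ eta <= delta, eta <= eps & eta <= 1].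
  by rewrite !ge_min !lexx !orbT.
have [k _ Hk] : \forall n \near \oo,
    mdist (iter n T x) (iter n.+1 T x) < eta.
  by apply: (cvgr_lt _ (steps_cvg0 x Ts Ted)).
exists k => p; suff: mdist (iter k T x) (iter (p + k) T x) < eps + eta by lra.
elim: p => [|p IH]; first by rewrite mdistxx; lra.
have sk : mdist (iter k T x) (T (iter k T x)) < eta by apply: Hk => /=.
have sp : mdist (iter (p + k) T x) (T (iter (p + k) T x)) < eta.
  by apply: Hk => /=; rewrite leq_addl.
have close : mdist (T (iter k T x)) (T (iter (p + k) T x)) <= eps.
  have [Mle|Mgt] := leP (M1 T (iter k T x) (iter (p + k) T x)) eps.
    exact: le_trans (contraction_le _ _ Ts) Mle.
  apply: Hdelta; rewrite Mgt /=.
  have skp : mdist (iter k T x) (T (iter k T x)) *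
      mdist (iter (p + k) T x) (T (iter (p + k) T x)) <= eta * 1.
    by apply: ler_pM; rewrite ?mdist_ge0//; lra.
  by apply: M1_lt; lra.
have := metric_triangle (iter k T x) (T (iter k T x)) (iter (p.+1 + k) T x).
rewrite addSn /=; lra.
Qed.

Lemma orbit_cvg (R : realType) (X : completeMetricType R) (T : X -> X) (x : X) :
  mdist_strict T -> eps_delta_contractive T -> cvgn (fun n => iter n T x).
Proof.
move=> Ts Ted; apply: cauchy_cvg; apply/cauchyP => eps eps0.
have eps20 : 0 < eps / 2 by rewrite divr_gt0.
have [k Hk] := orbit_tail_close x Ts Ted eps20.
exists (iter k T x); exists k => // n /= kn; rewrite ballEmdist /=.
by have := Hk (n - k)%N; rewrite subnK// mulrC divfK.
Qed.

(** * Fixed points *)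

(** When [a = mdist z (T z)] is positive, [M1 T u z] is equal to [a], and not
    merely close to it, for every late enough point [u] of the orbit; this is
    what makes the bound [psi a] uniform although [psi] may be irregular. *)
Lemma orbit_lim_fixed (R : realType) (X : metricType R) (T : X -> X)
    (psi : R -> R) (x z : X) :
  (forall t, 0 < t -> psi t < t) ->
  (forall u v : X, mdist (T u) (T v) <= psi (M1 T u v)) ->
  mdist (iter n T x) (iter n.+1 T x) @[n --> \oo] --> (0 : R) ->
  iter n T x @[n --> \oo] --> z -> T z = z.
Proof.
move=> psi_lt Tpsi steps0 xz; apply/esym/mdist_positivity.
set a := mdist z (T z); apply/le_anti; rewrite mdist_ge0 andbT leNgt.
apply/negP => a0.
(* With [e <= a - psi a], [mdist z (T u) < e] and [mdist (T u) (T z) <= psi a]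
   add up to less than [a]; [e <= a] and [e <= 1] make [a] the largest term of
   [M1 T u z]. *)
pose e := Num.min (a - psi a) (Num.min a 1).
have psia := psi_lt _ a0.
have e0 : 0 < e by rewrite !lt_min a0 ltr01 subr_gt0 psia.
have [e_psi e_a e_1] : [/\ e <= a - psi a, e <= a & e <= 1].
  by rewrite !ge_min !lexx !orbT.
have [N1 _ H1] : \forall n \near \oo, mdist z (iter n T x) < e.
  by apply: (cvgr_dist_lt xz).
have [N2 _ H2] : \forall n \near \oo,
    mdist (iter n T x) (iter n.+1 T x) < e.
  by apply: (cvgr_lt _ steps0).
pose n := maxn N1 N2; set u := iter n T x.
have zu : mdist z u < e by apply: H1 => /=; rewrite leq_maxl.
have zTu : mdist z (T u) < e.
  by apply: (H1 n.+1) => /=; rewrite leqW// leq_maxl.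
have su : mdist u (T u) < e by apply: H2 => /=; rewrite leq_maxr.
have M1a : M1 T u z = a.
  apply/le_anti; rewrite step_le_M1 andbT.
  have pa : mdist u (T u) * a <= a by rewrite ler_piMl//; lra.
  have p0 : 0 <= mdist u (T u) * a by rewrite mulr_ge0 ?mdist_ge0.
  have uz : mdist u z <= a by rewrite metric_sym; lra.
  rewrite /M1 -/a !ge_max uz lexx /=.
  rewrite !(le_trans (ler_div1D p0 (mdist_ge0 _ _)) pa) !andbT; lra.
have := Tpsi u z; rewrite M1a.
have := metric_triangle z (T u) (T z); rewrite -/a; lra.
Qed.

Lemma fixed_unique (R : realType) (X : metricType R) (T : X -> X) (y z : X) :
  mdist_strict T -> T y = y -> T z = z -> y = z.
Proof.
move=> Ts Ty Tz; apply/eqP; rewrite -[_ == _]negbK -mdist_gt0; apply/negP => yz.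
have := Ts y z; rewrite (M1_fixed _ Tz) Ty Tz mdistxx.
by rewrite (max_idPl (mdist_ge0 _ _)) yz ltxx => /(_ isT).
Qed.

(** As [x] tends to [y], [mdist x (T x)] and [mdist (T y) (T x)] differ by at
    most [mdist x y], which tends to [0]. *)
Lemma continuous_fixed (R : realType) (X : metricType R) (T : X -> X)
    (y : X) :
  T y = y ->
  {for y, continuous T} <-> (M1 T x y @[x --> y^'] --> (0 : R)).
Proof.
move=> Ty; split=> [/cvgrPdist_lt Tc|/cvgr0Pnorm_lt M0].
  apply/cvgr0Pnorm_lt => e e0; have e20 : 0 < e / 2 by rewrite divr_gt0.
  have := Tc _ e20; rewrite Ty => Te.
  have xe : \forall x \near y, mdist y x < e / 2.
    by apply: (cvgr_dist_lt (@cvg_id _ (nbhs y))).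
  apply: cvg_within; apply: filterS2 Te xe => x h1 h2.
  have := metric_triangle x y (T x); rewrite (metric_sym x y) => h3.
  rewrite M1_fixed// ger0_norm ?le_max ?mdist_ge0// gt_max (metric_sym x y).
  by apply/andP; split; lra.
apply/cvgrPdist_lt => e e0; have e20 : 0 < e / 2 by rewrite divr_gt0.
(* A punctured limit suffices since [T] fixes [y] itself. *)
rewrite Ty; have /= := M0 _ e20; rewrite near_withinE; apply: filterS => x H.
have [->|/H] := eqVneq x y; first by rewrite Ty mdistxx.
rewrite M1_fixed// ger0_norm ?le_max ?mdist_ge0// gt_max (metric_sym x y).
have := metric_triangle y x (T x) => h /andP[h1 h2]; lra.
Qed.

Theorem theorem2p1 (R : realType) (X : completeMetricType R) (T : X -> X)
  (psi_contraction : exists psi : R -> R,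
    [/\ forall t, 0 <= t -> 0 <= psi t,
        forall t, 0 < t -> psi t < t &
        forall x y : X, mdist (T x) (T y) <= psi (M1 T x y)])
  (eps_delta : forall eps : R, 0 < eps -> exists2 delta : R, 0 < delta &
    forall x y : X, eps < M1 T x y < eps + delta -> mdist (T x) (T y) <= eps) :
  exists y0 : X,
    [/\ T y0 = y0,
        forall y : X, T y = y -> y = y0,
        forall x : X, iter n T x @[n --> \oo] --> y0 &
        ~ {for y0, continuous T} <-> ~ (M1 T x y0 @[x --> y0^'] --> (0 : R))].
Proof.
have [psi [_ psi_lt Tpsi]] := psi_contraction.
have Ts : mdist_strict T.
  by move=> x y /psi_lt; exact: le_lt_trans.
have orbit_to_fixed (x : X) :
    T (limn (fun n => iter n T x)) = limn (fun n => iter n T x).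
  apply: (orbit_lim_fixed psi_lt Tpsi (steps_cvg0 x Ts eps_delta)).
  exact: orbit_cvg.
pose y0 := limn (fun n => iter n T (point : X)).
have Ty0 : T y0 = y0 by exact: orbit_to_fixed.
exists y0; split=> //.
- by move=> y Ty; exact: fixed_unique Ts Ty Ty0.
- move=> x; rewrite (fixed_unique Ts Ty0 (orbit_to_fixed x)).
  exact: orbit_cvg.
- by rewrite (continuous_fixed Ty0).
Qed.
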